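(* Let $A\in\mathbb{M}_n(\mathbb{C})$ be a CEPD matrix with $k=\mathrm{ind}(A)$. Then: (i) $A^kA^{\mathrm{cep}}=(A^k)^2(A^k)^\dagger A^D$; (ii) $A^{c\dagger}A^D=A^\dagger A^{\mathrm{cep}}$; (iii) $A^{\dagger,D}A^{\mathrm{cep}}A^\dagger=A^\dagger A^{\mathrm{cep}}A^\dagger$; (iv) $A^DA^kA^*=A^DA^kA^{D,*}=A^{\mathrm{cep}}A^kA^*$; (v) $(A^k)^2(A^k)^\dagger(A^{k+1})^\dagger=A^{\mathrm{cep}}$.
   Context: $\mathbb{M}_n(\mathbb{C})$ is the algebra of $n\times n$ complex matrices; $^*$ is conjugate transpose; $\mathcal{R}(\cdot)$ is column space; $A^0=I$. The index $\mathrm{ind}(A)$ is the smallest integer $k\ge 0$ with $\mathrm{rank}(A^k)=\mathrm{rank}(A^{k+1})$. $A^\dagger$ is the Moore-Penrose inverse. With $k=\mathrm{ind}(A)$, the Drazin inverse $A^D$ is the unique $X$ with $AX=XA$, $XAX=X$, $XA^{k+1}=A^k$. The core EP inverse of $A$, denoted here $A^{\mathrm{cep}}$, is the unique $X\in\mathbb{M}_n(\mathbb{C})$ with $XAX=X$ and $\mathcal{R}(X)=\mathcal{R}(A^k)=\mathcal{R}(X^* )$. $A$ is called core EP Drazin (CEPD) if $A^{\mathrm{cep}}A^D=A^DA^{\mathrm{cep}}$. The MPD inverse is $A^{\dagger,D}=A^\dagger AA^D$; the CMP inverse is $A^{c\dagger}=A^\dagger AA^DAA^\dagger$; the Drazin-Star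 matrix is $A^{D,*}=A^DAA^*$. *)

(* Defs.v *)
From HB Require Import structures.
From mathcomp Require Import all_boot all_order all_algebra.
From mathcomp Require Import complex reals.

Set Implicit Arguments.
Unset Strict Implicit.
Unset Printing Implicit Defensive.

Import Order.TTheory GRing.Theory Num.Theory.

Local Open Scope ring_scope.
Local Open Scope sesquilinear_scope.

(* MathComp's subspace relations are about row spaces, and the column space of
   X is the row space of X^T. *)
Definition same_range (C : numClosedFieldType) (m n1 n2 : nat)
  (X : 'M[C]_(m, n1)) (Y : 'M[C]_(m, n2)) : bool := (X^T == Y^T)%MS.

Section Index.
Variables (C : numClosedFieldType) (n : nat).
Implicit Type A : 'M[C]_n.

Lemma ind_exists A : exists k, \rank (A ^+ k) == \rank (A ^+ k.+1).
Proof.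
have H m : (exists k, \rank (A ^+ k) == \rank (A ^+ k.+1)) \/
           (\rank (A ^+ m) + m <= n)%N.
  elim: m => [|m [?|IH]]; [by right; rewrite addn0 rank_leq_row | by left |].
  have [e|ne] := boolP (\rank (A ^+ m) == \rank (A ^+ m.+1)).
    by left; exists m.
  right; apply: leq_trans IH; rewrite addnS -addSn leq_add2r ltn_neqAle.
  by rewrite eq_sym ne exprS mxrankM_maxr.
have [//|] := H n.+1.
by rewrite addnS ltnNge leq_addl.
Qed.

Definition ind A : nat := ex_minn (ind_exists A).

Lemma indP A : \rank (A ^+ ind A) = \rank (A ^+ (ind A).+1).
Proof. by rewrite /ind; case: ex_minnP => k /eqP. Qed.

Lemma ind_min A k :
  \rank (A ^+ k) = \rank (A ^+ k.+1) -> (ind A <= k)%N.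
Proof. by rewrite /ind; case: ex_minnP => j _ + /eqP; apply. Qed.

End Index.

(* The inverses below are defined over an arbitrary algebraically closed field
   with conjugation; the complex numbers are C = R[i] with R : realType. *)
Section GeneralizedInverses.
Variables (C : numClosedFieldType) (n : nat).
Implicit Types A X Y : 'M[C]_n.

Lemma adjmxM A X : (A *m X)^t* = X^t* *m A^t*.
Proof. by rewrite trmx_mul map_mxM. Qed.

Definition is_MP A X : bool :=
  [&& A *m X *m A == A, X *m A *m X == X,
      (A *m X)^t* == A *m X & (X *m A)^t* == X *m A].

Definition is_Drazin A X : bool :=
  [&& A *m X == X *m A, X *m A *m X == X &
      X *m A ^+ (ind A).+1 == A ^+ ind A].

Definition is_cep A X : bool :=
  [&& X *m A *m X == X, same_range X (A ^+ ind A) &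
      same_range (A ^+ ind A) (X^t*)].

Lemma mulmx_adj_eq0 m (B : 'M[C]_(m, n)) : B *m B^t* = 0 -> B = 0.
Proof.
move=> /matrixP BB; apply/matrixP => i j; move: (BB i i); rewrite !mxE => /eqP.
rewrite psumr_eq0 => [/allP /(_ j)|k _]; last by rewrite !mxE mul_conjC_ge0.
rewrite mem_index_enum => /(_ isT) /=.
by rewrite !mxE mul_conjC_eq0 => /eqP.
Qed.

Lemma submx_adj A : (A <= A^t* *m A)%MS.
Proof.
rewrite submxE; set K := cokermx _; apply/eqP.
have AK : A^t* *m A *m K = 0 by rewrite mulmx_coker.
have KA : K^t* *m A^t* *m (K^t* *m A^t*)^t* = 0.
  rewrite adjmxM !trmxCK -!mulmxA.
  by rewrite [A^t* *m _]mulmxA AK mulmx0.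
have /(congr1 (fun M => M^t*)) := mulmx_adj_eq0 KA.
by rewrite adjmxM !trmxCK => ->; apply/matrixP=> i j; rewrite !mxE conjC0.
Qed.

Lemma MP_exists A : exists X, is_MP A X.
Proof.
have H (B : 'M[C]_n) : exists M, [/\ B *m M *m B = B & (B *m M)^t* = B *m M].
  have /submxP[M0 eM] := submx_adj B.
  have eB : B^t* = B^t* *m B *m M0^t*.
    by rewrite {1}eM !adjmxM trmxCK.
  have h : (B *m M0^t*)^t* *m (B *m M0^t*) = B *m M0^t*.
    by rewrite adjmxM trmxCK -!mulmxA [M0 *m _]mulmxA [M0 *m _ *m _]mulmxA
               -[M0 *m _ *m _]mulmxA -eM.
  have hh : (B *m M0^t*)^t* = B *m M0^t*.
    by rewrite -{1}h adjmxM trmxCK h.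
  exists (M0^t*); split=> //.
  by rewrite -hh adjmxM trmxCK -mulmxA -eM.
have [M [M1 M3]] := H A.
have [N0 [N1 N3]] := H (A^t*).
set N := N0^t*.
have N1' : A *m N *m A = A.
  by rewrite -[LHS]trmxCK adjmxM [(A *m N)^t*]adjmxM trmxCK mulmxA N1 trmxCK.
have N4 : (N *m A)^t* = N *m A.
  by rewrite adjmxM trmxCK -N3 adjmxM trmxCK.
exists (N *m A *m M); apply/and4P.
have e1 : A *m (N *m A *m M) = A *m M by rewrite !mulmxA N1'.
have e2 : N *m A *m M *m A = N *m A.
  by rewrite -[N *m A *m M]mulmxA -mulmxA M1.
split; apply/eqP.
- by rewrite e1.
- by rewrite e2 !mulmxA -[N *m A *m N]mulmxA -[N *m (A *m N) *m A]mulmxA N1'.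
- by rewrite e1.
- by rewrite e2.
Qed.

Lemma rank_exp_submx A k : \rank (A ^+ k) = \rank (A ^+ k.+1) ->
  exists U, A ^+ k = U *m A ^+ k.+1.
Proof.
move=> rk; apply/submxP.
have s : (A ^+ k.+1 <= A ^+ k)%MS by rewrite exprS submxMl.
by have [_ <-] := mxrank_leqif_sup s; rewrite rk.
Qed.

Lemma trmxX A k : (A ^+ k)^T = A^T ^+ k.
Proof.
elim: k => [|k IH]; first by rewrite !expr0 trmx1.
by rewrite exprS exprSr -IH; exact: trmx_mul.
Qed.

Lemma Drazin_exists A : exists X, is_Drazin A X.
Proof.
set k := ind A.
have [U eU] := rank_exp_submx (indP A).
have [V eV] : exists V, A ^+ k = A ^+ k.+1 *m V.
  have rkT : \rank (A^T ^+ k) = \rank (A^T ^+ k.+1).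
    by rewrite -!trmxX !mxrank_tr indP.
  have [W /(congr1 trmx)] := rank_exp_submx rkT.
  by rewrite trmx_mul !trmxX trmxK => eW; exists W^T.
have {}eU : A ^+ k = U * A ^+ k.+1 by [].
have {}eV : A ^+ k = A ^+ k.+1 * V by [].
have HU j : U ^+ j * A ^+ (k + j) = A ^+ k.
  elim: j => [|j IH]; first by rewrite mul1r addn0.
  by rewrite exprSr -mulrA addnS -addSn exprD [U * _]mulrA -eU -exprD.
have HV j : A ^+ (j + k) * V ^+ j = A ^+ k.
  elim: j => [|j IH]; first by rewrite mulr1.
  by rewrite exprS mulrA addSn -addnS exprD -[_ * _ * V]mulrA -eV -exprD.
have c j : U ^+ j * A ^+ k = A ^+ k * V ^+ j.
  by rewrite -{1}(HV j) mulrA [(j + k)%N]addnC HU.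
have AX : A * (A ^+ k * V ^+ k.+1) = A ^+ k * V ^+ k.
  by rewrite mulrA -exprS (exprS V) mulrA -eV.
have XA : A ^+ k * V ^+ k.+1 * A = A ^+ k * V ^+ k.
  by rewrite -c -mulrA -exprSr (exprSr U) -mulrA -eU c.
exists (A ^+ k * V ^+ k.+1); apply/and3P; split; apply/eqP.
- by rewrite -[LHS]/(A * _) AX -XA.
- rewrite -[LHS]/(_ * A * _) XA -c -mulrA [A ^+ k * (_ * _)]mulrA -exprD mulrA.
  by rewrite HU.
- rewrite -[LHS]/(_ * _) -c -mulrA -exprD.
  by rewrite HU.
Qed.

Definition MPinv A : 'M[C]_n := xchoose (MP_exists A).
Definition Dinv A : 'M[C]_n := xchoose (Drazin_exists A).

Lemma MPinvP A : is_MP A (MPinv A). Proof. exact: xchooseP. Qed.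
Lemma DinvP A : is_Drazin A (Dinv A). Proof. exact: xchooseP. Qed.

Lemma same_rangeP (X Y Z W : 'M[C]_n) :
  X = Y *m Z -> Y = X *m W -> same_range X Y.
Proof.
move=> eX eY; apply/andP.
by split; [rewrite eX | rewrite eY]; rewrite trmx_mul submxMl.
Qed.

Lemma cep_exists A : exists X, is_cep A X.
Proof.
have /and4P[/eqP m1 /eqP m2 /eqP m3 _] := MPinvP (A ^+ ind A).
have /and3P[/eqP d1 /eqP d2 /eqP d3] := DinvP A.
set k := ind A in m1 m2 m3 d3 *; set B := A ^+ k in m1 m2 m3 d3 *.
set D := Dinv A in d1 d2 d3; set M := MPinv B in m1 m2 m3.
have AB : A *m B = A ^+ k.+1 by rewrite exprS.
have BA : B *m A = A ^+ k.+1 by rewrite exprSr.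
have DB : D *m B = B *m D.
  by apply: commrX; rewrite /GRing.comm -[D * A]/(D *m A) -d1.
have ADB : A *m D *m B = B by rewrite d1 -mulmxA AB d3.
have AX : A *m (D *m B *m M) = B *m M by rewrite !mulmxA ADB.
exists (D *m B *m M); apply/and3P; split.
- by rewrite -mulmxA AX -!mulmxA [B *m (M *m _)]mulmxA [B *m M *m _]mulmxA m1.
- apply: (@same_rangeP _ _ (D *m M) (B *m A)).
    by rewrite DB mulmxA.
  by rewrite mulmxA -[D *m B *m M *m B]mulmxA -[D *m B *m _]mulmxA
             [B *m (M *m B)]mulmxA m1 -mulmxA BA d3.
- apply: (@same_rangeP _ _ (A^t* *m B) (M *m D^t*)).
    by rewrite mulmxA -adjmxM AX m3 m1.
  by rewrite -mulmxA adjmxM m3 mulmxA.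
Qed.

Definition cep A : 'M[C]_n := xchoose (cep_exists A).

Lemma cepP A : is_cep A (cep A). Proof. exact: xchooseP. Qed.

Lemma MP_unique A X Y : is_MP A X -> is_MP A Y -> X = Y.
Proof.
move=> /and4P[/eqP x1 /eqP x2 /eqP x3 /eqP x4].
move=> /and4P[/eqP y1 /eqP y2 /eqP y3 /eqP y4].
have e1 : A *m X = A *m Y.
  by rewrite -[LHS]x3 -{1}y1 -[A *m Y *m A *m X]mulmxA adjmxM x3 y3 mulmxA x1.
have e2 : X *m A = Y *m A.
  rewrite -[LHS]x4 -{1}y1 -[A *m Y *m A]mulmxA mulmxA adjmxM x4 y4.
  by rewrite -mulmxA [A *m (X *m A)]mulmxA x1.
by rewrite -x2 -mulmxA e1 mulmxA e2 y2.
Qed.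

Lemma Drazin_unique A X Y : is_Drazin A X -> is_Drazin A Y -> X = Y.
Proof.
move=> /and3P[/eqP x1 /eqP x2 /eqP x3] /and3P[/eqP y1 /eqP y2 /eqP y3].
set k := ind A in x3 y3.
have cX : GRing.comm X A by rewrite /GRing.comm -[LHS]/(X *m A) -x1.
have cY : GRing.comm Y A by rewrite /GRing.comm -[LHS]/(Y *m A) -y1.
have pow Z j : GRing.comm Z A -> Z *m A *m Z = Z ->
    Z = Z ^+ j.+1 * A ^+ j /\ Z = A ^+ j * Z ^+ j.+1.
  move=> cZ zz.
  have zza : Z * Z * A = Z by rewrite -mulrA cZ mulrA -[LHS]/(Z *m A *m Z) zz.
  have E : Z = Z ^+ j.+1 * A ^+ j.
    elim: j => [|j IH]; first by rewrite expr1 mulr1.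
    rewrite {1}IH !(exprSr Z) [A ^+ j.+1]exprS mulrA -[Z ^+ j * Z * Z]mulrA.
    by rewrite -[Z ^+ j * (Z * Z) * A]mulrA zza.
  split=> //; rewrite {1}E.
  exact: commrX j (commr_sym (commrX j.+1 (commr_sym cZ))).
have [EX _] := pow X k cX x2.
have [_ EY] := pow Y k cY y2.
have yA : A ^+ k = A ^+ k.+1 * Y.
  by rewrite -(commrX k.+1 cY : Y * _ = _) -[RHS]/(Y *m _) y3.
have xA : A ^+ k = X * A ^+ k.+1 by rewrite -[RHS]/(X *m _) x3.
have -> : X = X * A * Y by rewrite [LHS]EX yA (exprSr A) !mulrA -EX.
by rewrite [RHS]EY xA (exprS A) -!mulrA -EY.
Qed.

Lemma cep_unique A X Y : is_cep A X -> is_cep A Y -> X = Y.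
Proof.
have comp (P Q S : 'M[C]_n) : same_range P Q -> same_range Q S ->
    exists Z, P = S *m Z.
  move=> /andP[PQ _] /andP[QS _].
  have /submxP[Z /(congr1 trmx)] := submx_trans PQ QS.
  by rewrite trmx_mul !trmxK => ->; exists Z^T.
have sym (P Q : 'M[C]_n) : same_range P Q -> same_range Q P.
  by rewrite /same_range andbC.
move=> /and3P[/eqP x1 x2 x3] /and3P[/eqP y1 y2 y3].
have [Z eY] := comp _ _ _ y2 (sym _ _ x2).
have [W eX] := comp _ _ _ (sym _ _ x3) y3.
have XAY : X *m A *m Y = Y by rewrite {1}eY mulmxA x1 -eY.
have /(congr1 (fun M => M^t*)) : Y^t* *m A^t* *m X^t* = X^t*.
  by rewrite {1}eX mulmxA -!adjmxM mulmxA y1 -eX.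
by rewrite -mulmxA !adjmxM !trmxCK XAY.
Qed.

Definition CEPD A : Prop := cep A *m Dinv A = Dinv A *m cep A.

Definition MPDinv A : 'M[C]_n := MPinv A *m A *m Dinv A.
Definition CMPinv A : 'M[C]_n := MPinv A *m A *m Dinv A *m A *m MPinv A.
Definition DrazinStar A : 'M[C]_n := Dinv A *m A *m A^t*.

End GeneralizedInverses.

(* Main.v *)
(* For a CEPD matrix the core EP inverse and the Drazin inverse coincide: with
   X = cep A and D = Dinv A, both A D X = X (range of X) and A X D = D (range
   of D) hold, so X D = D X forces X = D.  Hence the range of the adjoint of D
   is the range of A^(ind A), so A D is an orthogonal projector and D^j is the
   Moore-Penrose inverse of A^j for every j >= max(1, ind A). *)
Require Import Defs.
From mathcomp Require Import all_boot all_order all_algebra.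
From mathcomp Require Import complex reals.

Import Order.TTheory GRing.Theory Num.Theory.
Set Implicit Arguments.
Unset Strict Implicit.
Unset Printing Implicit Defensive.

Local Open Scope ring_scope.
Local Open Scope sesquilinear_scope.

(** Turns range inclusion into a right factor, so that any matrix fixing [Y] from the left also
    fixes [X]. *)
Lemma same_range_factor (C : numClosedFieldType) (m n1 n2 : nat)
    (X : 'M[C]_(m, n1)) (Y : 'M[C]_(m, n2)) :
  same_range X Y -> exists Z, X = Y *m Z.
Proof.
move=> /andP[/submxP[Z eX] _]; exists Z^T.
by rewrite -[LHS]trmxK eX trmx_mul trmxK.
Qed.

Section DrazinCoreEP.
Variables (C : numClosedFieldType) (n : nat).
Implicit Types A : 'M[C]_n.

Lemma Dinv_comm A : A *m Dinv A = Dinv A *m A.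
Proof. by have /and3P[/eqP] := DinvP A. Qed.

Lemma Dinv_mulDAD A : Dinv A *m A *m Dinv A = Dinv A.
Proof. by have /and3P[_ /eqP] := DinvP A. Qed.

Lemma Dinv_mulADD A : A *m Dinv A *m Dinv A = Dinv A.
Proof. by rewrite Dinv_comm Dinv_mulDAD. Qed.

Lemma mulAD_expmx A : A *m Dinv A *m A ^+ ind A = A ^+ ind A.
Proof.
have /and3P[_ _ /eqP dk] := DinvP A.
rewrite Dinv_comm -mulmxA.
by rewrite -[A *m A ^+ _]/(A * A ^+ _) -exprS.
Qed.

Lemma expmx_mulDA A : A ^+ ind A *m (Dinv A *m A) = A ^+ ind A.
Proof.
rewrite -Dinv_comm -[LHS]/(_ * (_ * _)).
have cAD : GRing.comm (A * Dinv A) A.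
  by apply/commr_sym/commrM => //; exact: Dinv_comm.
by rewrite -(commrX (ind A) cAD) -[LHS]/(_ *m _ *m _) mulAD_expmx.
Qed.

(** Each factor [A] cancels one [Dinv A] by [A D D = D]. This puts the range of [D] inside that of
    every power of [A], so whatever fixes [A ^+ j] from the left fixes [D]. *)
Lemma mulAXDX A j : A ^+ j *m Dinv A ^+ j.+1 = Dinv A.
Proof.
elim: j => [|j IH]; first by rewrite -[LHS]/(1 * Dinv A) mul1r.
have AD : A * Dinv A ^+ j.+2 = Dinv A ^+ j.+1.
  by rewrite !exprS !mulrA [A * _ * _]Dinv_mulADD.
by rewrite -[LHS]/(_ * _) exprSr -mulrA AD; exact: IH.
Qed.

(** [X A] fixes [X = cep A], hence everything in the range of [X]. *)
Lemma cep_mulXA A : cep A *m A *m A ^+ ind A = A ^+ ind A.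
Proof.
have /and3P[/eqP XAX sX _] := cepP A.
have /same_range_factor[W ->] : same_range (A ^+ ind A) (cep A).
  by rewrite /same_range andbC.
by rewrite mulmxA XAX.
Qed.

Lemma cep_mulXAD A : cep A *m A *m Dinv A = Dinv A.
Proof. by rewrite -{1}(mulAXDX A (ind A)) mulmxA cep_mulXA mulAXDX. Qed.

Lemma mulAD_cep A : A *m Dinv A *m cep A = cep A.
Proof.
have /and3P[_ /same_range_factor[Z ->] _] := cepP A.
by rewrite mulmxA mulAD_expmx.
Qed.

Lemma mulA_cep_D A : A *m cep A *m Dinv A = Dinv A.
Proof.
(* Expanding [D] as [A D D] makes [X A D = D] applicable inside the product. *)
rewrite -{1}Dinv_mulADD -mulmxA !(mulmxA (cep A)) cep_mulXAD mulmxA.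
by rewrite Dinv_mulADD.
Qed.

Lemma CEPD_cepE A : CEPD A -> cep A = Dinv A.
Proof. by move=> h; rewrite -mulAD_cep -mulmxA -h mulmxA mulA_cep_D. Qed.

Lemma CEPD_AD_herm A : CEPD A -> (A *m Dinv A)^t* = A *m Dinv A.
Proof.
move=> /CEPD_cepE XD; have /and3P[_ _] := cepP A; rewrite XD.
set P := A *m Dinv A => sX.
have /same_range_factor[V DV] : same_range ((Dinv A)^t*) (A ^+ ind A).
  by rewrite /same_range andbC.
(* The columns of the adjoint of [P] lie in the range of the adjoint of [D], that is, of
   [A ^+ ind A], which [P] fixes. Since [P *m P^t*] is Hermitian, so is [P]. *)
have PP : P *m P^t* = P^t*.
  by rewrite [P^t*]adjmxM DV !mulmxA mulAD_expmx.
by have := congr1 (fun M => M^t*) PP; rewrite adjmxM trmxCK PP.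
Qed.

Lemma expmx_mul_Dinv A j : A ^+ j.+1 *m Dinv A ^+ j.+1 = A *m Dinv A.
Proof. by rewrite -[LHS]/(_ * _) exprS -mulrA [_ ^+ j * _]mulAXDX. Qed.

(** Both products of the two powers collapse to [A D], which fixes each power; the Penrose equations
    then reduce to [A D] being Hermitian. *)
Lemma CEPD_MPinv_exp A j : CEPD A -> (ind A <= j.+1)%N ->
  MPinv (A ^+ j.+1) = Dinv A ^+ j.+1.
Proof.
move=> hA le_ind; apply: (@MP_unique _ _ (A ^+ j.+1)); first exact: MPinvP.
have DXA : Dinv A ^+ j.+1 *m A ^+ j.+1 = A *m Dinv A.
  rewrite -(expmx_mul_Dinv A j).
  by apply/commrX/commr_sym/commrX; exact: Dinv_comm.
have PA : A *m Dinv A *m A ^+ j.+1 = A ^+ j.+1.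
  by rewrite -(subnKC le_ind) exprD [LHS]mulmxA mulAD_expmx.
have PD : A *m Dinv A *m Dinv A ^+ j.+1 = Dinv A ^+ j.+1.
  by rewrite exprS [LHS]mulmxA Dinv_mulADD.
by apply/and4P; rewrite DXA expmx_mul_Dinv PA PD CEPD_AD_herm.
Qed.

End DrazinCoreEP.

Theorem theorem3p8 (R : realType) (n : nat) (A : 'M[R[i]]_n) (k : nat)
    (hA : CEPD A) (hk : k = ind A) :
  [/\ A ^+ k *m cep A = (A ^+ k) ^+ 2 *m MPinv (A ^+ k) *m Dinv A,
      CMPinv A *m Dinv A = MPinv A *m cep A,
      MPDinv A *m cep A *m MPinv A = MPinv A *m cep A *m MPinv A,
      Dinv A *m A ^+ k *m A^t* = Dinv A *m A ^+ k *m DrazinStar A /\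
      Dinv A *m A ^+ k *m DrazinStar A = cep A *m A ^+ k *m A^t*
    & (A ^+ k) ^+ 2 *m MPinv (A ^+ k) *m MPinv (A ^+ k.+1) = cep A].
Proof.
(* [B *m MPinv B] projects onto the range of [A ^+ j], which contains that of [D]. Used below with
   [j = k] and [j = 1]. *)
have BMD (j : nat) (B := A ^+ j) : B *m MPinv B *m Dinv A = Dinv A.
  have /and4P[/eqP BMB _ _ _] := MPinvP B.
  by rewrite -{1}(mulAXDX A j) mulmxA BMB mulAXDX.
have B2 (B : 'M[R[i]]_n) M : B ^+ 2 *m M = B *m (B *m M) by rewrite mulmxA.
have DAk : Dinv A *m A ^+ k *m DrazinStar A = Dinv A *m A ^+ k *m A^t*.
  rewrite /DrazinStar -!mulmxA; congr (_ *m _).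
  (* [A ^+ k] absorbs the factor [D A] of [DrazinStar A]. *)
  by rewrite !mulmxA -(mulmxA (A ^+ k)) hk expmx_mulDA.
rewrite DAk (CEPD_cepE hA); split.
- by rewrite B2 -[RHS]mulmxA BMD.
- rewrite /CMPinv -!mulmxA (mulmxA A (MPinv A)) (BMD 1%N).
  by rewrite (mulmxA A) Dinv_mulADD.
- by rewrite /MPDinv -2!(mulmxA (MPinv A)) Dinv_mulADD.
- by [].
(* Only the inverse of [A ^+ k.+1] becomes a power of [D]; that of [A ^+ k] is absorbed by [BMD], so
   [k = 0] needs no separate case. *)
- rewrite CEPD_MPinv_exp ?hk // -hk B2 exprS -mulmxA.
  rewrite -[Dinv A * _]/(Dinv A *m _) (mulmxA _ (Dinv A)) BMD.
  by rewrite -[Dinv A *m _]/(Dinv A * _) -exprS mulAXDX.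
Qed.
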